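(* For every positive integer $n$, $2^{n-2}-\frac n2\le f(n,S_3)$. In general, for every fixed integer $k\ge 2$, $\frac{2^{n-1}}{k-1}-O\left(n^{k-2}\right)\le f(n,S_k)$.
   Context: $[n]=\{1,\dots,n\}$ and $\mathcal{P}(n)$ is the set of all subsets of $[n]$. $S_k$ denotes the star with $k$ edges. For a graph $G$, a hypergraph $H$ is called Berge-$G$ if there is a copy of $G$ with $V(G)\subseteq V(H)$ and a bijection $g:E(G)\to E(H)$ such that $e\subseteq g(e)$ for every $e\in E(G)$. A family of subsets of $[n]$ (viewed as a hypergraph with vertex set $[n]$) is $G$-free if it contains no subfamily that is a Berge-$G$ hypergraph. $f(n,G)$ denotes the smallest number of colors in a coloring (partition) of $\mathcal{P}(n)$ such that every color class is $G$-free. The $O(\cdot)$ is as $n\to\infty$ with $k$ fixed; the implied constant may depend on $k$. *)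

(* Defs.v *)
From mathcomp Require Import all_boot.

Set Implicit Arguments.
Unset Strict Implicit.
Unset Printing Implicit Defensive.

Record sgraph := SGraph {
  vertex : finType;
  adj : rel vertex;
  adj_sym : symmetric adj;
  adj_irr : irreflexive adj }.

Definition edges (G : sgraph) : {set {set vertex G}} :=
  [set [set x; y] | x in vertex G, y in vertex G & adj x y].

(* Vertex 0 is the centre and the vertices 1, ..., k are the leaves. *)
Definition star_rel (k : nat) : rel 'I_k.+1 :=
  fun x y => (x == ord0) (+) (y == ord0).

Lemma star_sym (k : nat) : symmetric (@star_rel k).
Proof. by move=> x y; rewrite /star_rel addbC. Qed.

Lemma star_irr (k : nat) : irreflexive (@star_rel k).
Proof. by move=> x; rewrite /star_rel addbb. Qed.

Definition star (k : nat) : sgraph := SGraph (@star_sym k) (@star_irr k).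

(* [phi] places a copy of [G] on the vertex set [V] of the hypergraph [H];
   only the values of [g] on [edges G] matter, and there [g] is a bijection
   onto [H]. *)
Definition berge (G : sgraph) (V : finType) (H : {set {set V}}) : bool :=
  [exists phi : {ffun vertex G -> V},
   [exists g : {ffun {set vertex G} -> {set V}},
     [&& injectiveb phi,
         dinjectiveb g (edges G),
         g @: edges G == H
       & [forall e in edges G, phi @: e \subset g e]]]].

Definition berge_free (G : sgraph) (V : finType) (F : {set {set V}}) : bool :=
  ~~ [exists H : {set {set V}}, (H \subset F) && berge G H].

(* The ground set {1, ..., n} is encoded as ['I_n], and the colour classes are
   the (nonempty) blocks of a partition of its power set. *)
Definition free_coloring (n : nat) (G : sgraph)
    (P : {set {set {set 'I_n}}}) : bool :=
  partition P [set: {set 'I_n}] && [forall F in P, berge_free G F].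

Definition discrete_coloring (n : nat) : {set {set {set 'I_n}}} :=
  [set [set A] | A : {set 'I_n}].

(* If [G] has at least two edges, then the discrete colouring is admissible and
   this is the minimum number of colours, see [fP]; graphs with no
   admissible colouring get a dummy value. *)
Definition f (n : nat) (G : sgraph) : nat :=
  #|[arg min_(P < discrete_coloring n | free_coloring G P) #|P|]|.

Lemma discrete_coloring_free (n : nat) (G : sgraph) :
  1 < #|edges G| -> free_coloring G (discrete_coloring n).
Proof.
move=> G2; apply/andP; split.
  apply/and3P; split.
  - apply/eqP/setP=> A; rewrite inE; apply/bigcupP.
    by exists [set A]; rewrite ?imset_f ?set11.
  - apply/trivIsetP=> _ _ /imsetP[A _ ->] /imsetP[B _ ->] AB.
    by rewrite disjoints1 inE; apply: contraNneq AB => ->.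
  - by apply/imsetP=> -[A _ /setP/(_ A)]; rewrite !inE eqxx.
apply/forall_inP=> _ /imsetP[A _ ->]; apply/existsP=> -[H /andP[HA]].
case/existsP=> phi /existsP[g /and4P[_ /dinjectiveP g_inj /eqP gH _]].
move: (subset_leq_card HA); rewrite cards1 -gH card_in_imset //.
by rewrite leqNgt G2.
Qed.

Lemma fP (n : nat) (G : sgraph) : 1 < #|edges G| ->
  (exists2 P : {set {set {set 'I_n}}}, free_coloring G P & #|P| = f n G) /\
  (forall P : {set {set {set 'I_n}}}, free_coloring G P -> f n G <= #|P|).
Proof.
move=> G2; rewrite /f; case: arg_minnP => [|P PG Pmin].
  exact: discrete_coloring_free.
by split=> //; exists P.
Qed.

Lemma card_edges_star (k : nat) : #|edges (star k)| = k.
Proof.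
have -> : edges (star k) = [set [set ord0; lift ord0 i] | i : 'I_k].
  apply/setP=> e; apply/imset2P/imsetP.
  - case=> x y _; rewrite inE /= /star_rel.
    case: (unliftP ord0 x) => [i|] ->; case: (unliftP ord0 y) => [j|] ->;
      rewrite ?eqxx ?(eq_sym _ ord0) ?(negPf (neq_lift _ _)) //= => _ ->.
      by exists i; rewrite // setUC.
    by exists j.
  - case=> i _ ->; exists ord0 (lift ord0 i) => //.
    by rewrite inE /= /star_rel eqxx eq_sym (negPf (neq_lift _ _)).
rewrite card_imset ?card_ord // => i j /setP/(_ (lift ord0 i)).
by rewrite !inE eqxx orbT (inj_eq lift_inj) eq_sym (negPf (neq_lift _ _)) /= =>
  /esym/eqP.
Qed.

(* Main.v *)
Require Import Defs.
From mathcomp Require Import all_boot all_order all_algebra.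
From mathcomp Require Import zify lra.
From mathcomp Require Import all_classical all_reals all_analysis.
Import Order.TTheory GRing.Theory Num.Theory.
Import numFieldNormedType.Exports.

(** The bound comes from looking at a single vertex [v].  In a colour class
    without a Berge star [S_k], fewer than [k] of the sets [A] with at least
    [k] elements contain [v].  Indeed, given [k] such sets, the links [A :\ v]
    are [k] distinct sets with at least [k - 1] elements each, and such a
    system always has distinct representatives ([distinct_sets_sdr]): Hall's
    condition could only fail for all [k] links together, if their union had
    [k - 1] elements, and then the links would all be equal.  Joining [v] to
    the representatives gives a Berge star centred at [v] ([berge_star],
    [star_free_degree]).

    Of the [2 ^ (n - 1)] subsets of the ground set that contain [v], exactly
    [\sum_(j < k - 1) 'C(n - 1, j)] have fewer than [k] elements, and the
    classes share the others, at most [k - 1] each.  Hence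
    [2 ^ (n - 1) <= (k - 1) * f n (star k) + \sum_(j < k - 1) 'C(n - 1, j)]
    ([star_coloring_bound]).  For [k = 3] the sum of binomials is [n], which
    gives the exact first bound; in general it is at most
    [(k - 1) * n ^ (k - 2)], so that the error term [n ^ (k - 2)] works. *)

(** Representatives can be chosen greedily along [s]: the sets before position
    [i] use up at most [i] points, fewer than the set there has.  The sets are
    indexed by [T], so that different indices may carry the same set. *)
Lemma greedy_sdr (T : eqType) (V : finType) (L : T -> {set V}) (a0 : T) (v0 : V)
    (s : seq T) :
  uniq s -> (forall i, i < size s -> i < #|L (nth a0 s i)|) ->
  exists2 h : T -> V, {in s &, injective h} & {in s, forall a, h a \in L a}.
Proof.
elim/last_ind: s => [|s a IHs] /=; first by exists (fun=> v0).
rewrite rcons_uniq size_rcons => /andP[a_s s_uniq] L_big.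
have [i i_s|h h_inj hL] := IHs s_uniq.
  by have := L_big i; rewrite nth_rcons i_s ltnS ltnW //; apply.
(* [x] represents [a] and differs from the representatives chosen before. *)
have /subsetPn[x xL x_h] : ~~ (L a \subset map h s).
  apply/negP=> /subset_leq_card L_sub.
  have := L_big (size s); rewrite nth_rcons ltnn eqxx ltnS leqnn => /(_ isT).
  by rewrite ltnNge (leq_trans L_sub) // (leq_trans (card_size _)) // size_map.
exists (fun b => if b == a then x else h b) => [b c|b];
    rewrite !mem_rcons !inE; last first.
  by have [->|_] := eqVneq b a => //= /hL.
have [->|ba] := eqVneq b a; have [->|ca] := eqVneq c a => //=.
- by move=> _ c_s xh; rewrite xh map_f in x_h.
- by move=> b_s _ hx; rewrite -hx map_f in x_h.
- exact: h_inj.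
Qed.

(** The greedy choice alone would need one more point in the last set.
    Distinctness supplies it: some point [x] lies in [L a] but not in [L b].
    If [x] represents [a] and [b] is treated last, then removing [x] from the
    other sets costs [L b] nothing, and the sets treated in between can
    afford the loss. *)
Lemma distinct_sets_sdr (T V : finType) (L : T -> {set V}) (U : {set T}) :
  1 < #|U| -> {in U &, injective L} ->
  (forall a, a \in U -> #|U| <= #|L a|.+1) ->
  exists2 h : T -> V, {in U &, injective h} & {in U, forall a, h a \in L a}.
Proof.
move=> U_gt1 L_inj L_big.
have [a [b [x [aU bU ab xa xb]]]] :
    exists a b x, [/\ a \in U, b \in U, a != b, x \in L a & x \notin L b].
  case/card_gt1P: U_gt1 => a [b [aU bU ab]].
  have [/subsetPn[x xa xb]|] := boolP (~~ (L a \subset L b)).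
    by exists a, b, x.
  rewrite negbK => sab.
  have /subsetPn[x xb xa] : ~~ (L b \subset L a).
    apply: contra ab => sba; apply/eqP/L_inj => //.
    by apply/eqP; rewrite finset.eqEsubset sab.
  by exists b, a, x; rewrite eq_sym.
pose r := enum (U :\ a :\ b).
have r_size : #|U| = (size r).+2.
  by rewrite /r -cardE (cardsD1 a U) aU (cardsD1 b (U :\ a)) !inE eq_sym ab bU.
have br : b \notin r by rewrite mem_enum !inE eqxx.
have r_uniq : uniq (rcons r b) by rewrite rcons_uniq br enum_uniq.
have [i|h h_inj hL] := @greedy_sdr T V (fun c => L c :\ x) b x _ r_uniq.
  rewrite size_rcons ltnS nth_rcons => i_r.
  have [i_lt|r_le] := ltnP i (size r); last first.
    rewrite if_same; have := L_big b bU; rewrite (cardsD1 x (L b)) (negPf xb).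
    by rewrite r_size ltnS; apply: leq_trans; rewrite ltnS.
  have : nth b r i \in U by have := mem_nth b i_lt; rewrite mem_enum !inE => /and3P[].
  by move=> /L_big; rewrite (cardsD1 x (L _)) r_size; case: (x \in _) => /=; lia.
have in_r c : c \in U -> c != a -> c \in rcons r b.
  by move=> cU ca; rewrite mem_rcons inE mem_enum !inE cU ca; case: (c == b).
exists (fun c => if c == a then x else h c) => [c d cU dU|c cU]; last first.
  have [->//|ca] := eqVneq c a.
  by have /hL := in_r c cU ca; rewrite !inE => /andP[].
have h_neq e : e \in U -> e != a -> h e != x.
  by move=> eU ea; have /hL := in_r e eU ea; rewrite !inE => /andP[].
have [->|ca] := eqVneq c a; have [->|da] := eqVneq d a => //.
- by move/esym/eqP; rewrite (negPf (h_neq _ _ _)).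
- by move/eqP; rewrite (negPf (h_neq _ _ _)).
- by apply: h_inj; apply: in_r.
Qed.

Lemma star_edgesE (k : nat) :
  edges (star k) = [set [set ord0; lift ord0 i] | i : 'I_k].
Proof.
apply/setP=> e; apply/imset2P/imsetP=> [[x y _]|[i _ ->]].
  rewrite inE /= /star_rel.
  case: (unliftP ord0 x) => [i|] ->; case: (unliftP ord0 y) => [j|] ->;
    rewrite ?eqxx ?(eq_sym _ ord0) ?(negPf (neq_lift _ _)) //= => _ ->.
    by exists i; rewrite // finset.setUC.
  by exists j.
exists ord0 (lift ord0 i) => //.
by rewrite inE /= /star_rel eqxx eq_sym (negPf (neq_lift _ _)).
Qed.

(** The centre of the star goes to [v], leaf [i] goes to [x i], and the edge to
    leaf [i] goes to [A i]. *)
Lemma berge_star (k : nat) (V : finType) (v : V) (x : 'I_k -> V)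
    (A : 'I_k -> {set V}) :
  injective x -> injective A -> (forall i, v \in A i) ->
  (forall i, x i \in A i :\ v) -> berge (star k) [set A i | i : 'I_k].
Proof.
move=> x_inj A_inj vA xA.
pose phi : {ffun vertex (star k) -> V} := [ffun y : 'I_k.+1 => if unlift ord0 y is Some i then x i else v].
(* An edge of the star has exactly one leaf, so the pick is forced. *)
pose g : {ffun {set vertex (star k)} -> {set V}} := [ffun e : {set 'I_k.+1} =>
  if [pick i | lift ord0 i \in e] is Some i then A i else finset.set0].
have phi0 : phi ord0 = v by rewrite ffunE unlift_none.
have phiS i : phi (lift ord0 i) = x i by rewrite ffunE liftK.
have gE i : g [set ord0; lift ord0 i] = A i.
  rewrite ffunE; case: pickP => [j|/(_ i)]; last by rewrite !inE eqxx orbT.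
  by rewrite !inE (eq_sym _ ord0) (negPf (neq_lift _ _)) (inj_eq lift_inj) => /eqP->.
apply/existsP; exists phi; apply/existsP; exists g; apply/and4P; split.
- apply/injectiveP=> y z; case: (unliftP ord0 y) => [i|] ->;
    case: (unliftP ord0 z) => [j|] ->; rewrite ?phi0 ?phiS //.
  + by move/x_inj->.
  + by move=> xi; have := xA i; rewrite xi !inE eqxx.
  + by move=> xi; have := xA j; rewrite -xi !inE eqxx.
- rewrite star_edgesE; apply/dinjectiveP=> _ _ /imsetP[i _ ->] /imsetP[j _ ->].
  by rewrite !gE => /A_inj->.
- by rewrite star_edgesE -imset_comp; apply/eqP/eq_imset=> i; exact: gE.
- rewrite star_edgesE; apply/forall_inP=> _ /imsetP[i _ ->]; rewrite gE.
  apply/fintype.subsetP=> _ /imsetP[y yi ->]; move: yi; rewrite !inE.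
  case/pred2P=> ->; rewrite ?phi0 ?phiS //.
  by have := xA i; rewrite !inE => /andP[].
Qed.

(** The size condition is [k <= #|A|] because the links [A :\ v] of [k] such
    sets need [k - 1] points each to have distinct representatives. *)
Lemma star_free_degree (k : nat) (V : finType) (v : V) (F : {set {set V}}) :
  1 < k -> berge_free (star k) F ->
  #|[set A in F | (v \in A) && (k <= #|A|)]| < k.
Proof.
move=> k_gt1; apply: contraR; rewrite -leqNgt => k_le.
have [/= U [UF cardU]] : exists U : {set {set V}},
    U \subset [set A in F | (v \in A) && (k <= #|A|)] /\ #|U| = k.
  exists [set A in take k (enum [set A in F | (v \in A) && (k <= #|A|)])].
  split.
    by apply/fintype.subsetP=> A; rewrite inE => /mem_take; rewrite mem_enum.
  rewrite cardsE (card_uniqP _) ?take_uniq ?enum_uniq //.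
  by rewrite size_takel // -cardE.
have inU A : A \in U -> [/\ A \in F, v \in A & k <= #|A|].
  by move/(fintype.subsetP UF); rewrite inE => /and3P[].
have [||A /inU[_ vA kA]|h h_inj hA] :=
    @distinct_sets_sdr _ V (fun A => A :\ v) U.
- by rewrite cardU.
- move=> A B /inU[_ vA _] /inU[_ vB _] AB.
  by rewrite -(finset.setD1K vA) AB finset.setD1K.
- by rewrite cardU (leq_trans kA) // (cardsD1 v A) vA.
have Uk (i : 'I_k) : i < #|U| by rewrite cardU.
pose A i : {set V} := enum_val (Ordinal (Uk i)).
have AU i : A i \in U by exact: enum_valP.
have A_inj : injective A by move=> i j /enum_val_inj[/val_inj].
apply/existsP; exists [set A i | i : 'I_k]; apply/andP; split.
  by apply/fintype.subsetP=> _ /imsetP[i _ ->]; have [] := inU _ (AU i).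
apply: (@berge_star k V v (h \o A)) => //= [i j /h_inj e|i|i].
- by apply: A_inj; apply: e.
- by have [] := inU _ (AU i).
- exact: hA.
Qed.

Lemma card_small_subsets (V : finType) (B : {set V}) (k : nat) :
  #|[set C : {set V} | (C \subset B) && (#|C| < k)]| = \sum_(j < k) 'C(#|B|, j).
Proof.
elim: k => [|k IHk].
  by rewrite big_ord0; apply: eq_card0 => C; rewrite !inE andbF.
rewrite big_ord_recr /= -IHk -cards_draws -cardsUI.
rewrite [X in _ = _ + X]eq_card0 => [|C]; last first.
  by rewrite !inE; case: (_ \subset _) => //=; case: ltngtP.
by rewrite addn0; apply: eq_card => C; rewrite !inE -andb_orr ltnS leq_eqVlt orbC.
Qed.

(** Adding [v] embeds the subsets of [[set~ v]] with at least [k] elements into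
    the sets counted on the right; the sum of binomials counts the smaller
    subsets. *)
Lemma leq_card_large_sets (V : finType) (v : V) (k : nat) :
  2 ^ #|V|.-1 <=
    #|[set A : {set V} | (v \in A) && (k < #|A|)]| + \sum_(j < k) 'C(#|V|.-1, j).
Proof.
pose W := [set~ v].
have cardW : #|W| = #|V|.-1 by rewrite cardsC1.
rewrite -cardW -card_powerset -card_small_subsets.
pose S := [set C : {set V} | (C \subset W) && (#|C| < k)].
rewrite -(cardsID S (powerset W)) addnC leq_add //; last first.
  by apply: subset_leq_card; apply: subsetIr.
have vN C : C \in powerset W :\: S -> v \notin C.
  rewrite !inE => /andP[_ /fintype.subsetP CW].
  by apply/negP=> /CW; rewrite !inE eqxx.
rewrite -(card_in_imset (f := fun C => v |: C)) => [|C D /vN vC /vN vD CD].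
  apply: subset_leq_card; apply/fintype.subsetP=> _ /imsetP[C CS ->].
  have vC := vN C CS; move: CS; rewrite !inE eqxx /= cardsU1 vC ltnS.
  by case/andP=> /nandP[/negP|]; rewrite -?leqNgt.
by rewrite -(finset.setU1K vC) CD finset.setU1K.
Qed.

(** Any vertex can serve as the centre of the argument; it is [ord0] here, which
    is where [0 < n] enters. *)
Lemma star_coloring_bound (n k : nat) : 0 < n -> 1 < k ->
  2 ^ n.-1 <= (k.-1 * f n (star k)) + \sum_(j < k.-1) 'C(n.-1, j).
Proof.
case: n => // n _; case: k => // k k_gt0.
have [] := @fP n.+1 (star k.+1); first by rewrite card_edges_star.
case=> P /andP[P_part /forall_inP P_free] <- _.
have := @leq_card_large_sets 'I_n.+1 ord0 k; rewrite card_ord /= => /leq_trans; apply.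
rewrite leq_add2r.
set D := [set A : {set 'I_n.+1} | _].
have -> : #|D| = \sum_(F in P) #|F :&: D|.
  rewrite -sum1_card (eq_bigl (fun A => (A \in [set: {set 'I_n.+1}]) && (A \in D)));
    last by move=> A; rewrite [in RHS]inE.
  rewrite (set_partition_big_cond _ P_part); apply: eq_bigr => F _.
  by rewrite -sum1_card; apply: eq_bigl => A; rewrite [in RHS]inE.
rewrite mulnC -sum_nat_const; apply: leq_sum => F /P_free F_free.
have := @star_free_degree k.+1 _ ord0 F k_gt0 F_free; rewrite ltnS.
by apply: leq_trans; apply: subset_leq_card; apply/fintype.subsetP=> A; rewrite !inE.
Qed.

Lemma leq_bin_expn (n j : nat) : 'C(n, j) <= n ^ j.
Proof.
elim: j => [|j IHj]; first by rewrite bin0.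
rewrite (@leq_trans (j.+1 * 'C(n, j.+1))) ?leq_pmull //.
by rewrite mul_bin_left expnS leq_mul ?leq_subr.
Qed.

Lemma sum_bin_le (n k : nat) : 0 < n -> 1 < k ->
  \sum_(j < k.-1) 'C(n.-1, j) <= k.-1 * n ^ (k - 2).
Proof.
move=> n_gt0 k_gt1; rewrite -[X in X * _]card_ord -sum_nat_const.
apply: leq_sum => j _; apply: leq_trans (leq_bin_expn _ _) _.
have jk : j <= k - 2 by have := ltn_ord j; lia.
apply: (@leq_trans (n ^ j)); last exact: leq_pexp2l.
by case: (nat_of_ord j) => // i; rewrite leq_exp2r // leq_pred.
Qed.

Local Open Scope classical_set_scope.
Local Open Scope ring_scope.

Theorem proposition2 (R : realType) :
  (forall n : nat, (0 < n)%N ->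
     (2 : R) ^ (n%:Z - 2) - n%:R / 2 <= (f n (star 3))%:R) /\
  (forall k : nat, (2 <= k)%N ->
     exists2 err : nat -> R,
       err =O_\oo (fun n : nat => (n%:R : R) ^+ (k - 2)) &
       forall n : nat, (0 < n)%N ->
         (2 : R) ^ (n%:Z - 1) / (k%:R - 1) - err n <= (f n (star k))%:R).
Proof.
split=> [[//|n] _|k k_gt1].
  have := @star_coloring_bound n.+1 3 isT isT.
  rewrite big_ord_recl big_ord1 /= bin0 bin1 add1n -(ler_nat R) natrD natrM natrX.
  have -> : n.+1%:Z - 2 = n%:Z - 1 by lia.
  rewrite expfzDr ?pnatr_eq0 // -exprnP exprN1.
  set p := 2 ^+ n; set c := (f _ _)%:R; lra.
(* The error is [n ^ (k - 2)] itself, with no constant, because dividing the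
   bound by [k - 1] cancels the number of binomials in the sum. *)
exists (fun n => n%:R ^+ (k - 2)) => [|[//|n] _].
  by apply/eqO_exP; exists 1 => //; near=> n; rewrite mul1r.
have := leq_trans (@star_coloring_bound n.+1 k isT k_gt1)
  (leq_add (leqnn _) (@sum_bin_le n.+1 k isT k_gt1)).
have -> : n.+1%:Z - 1 = n%:Z by lia.
have k1 : (0 : R) < k.-1%:R by rewrite ltr0n; lia.
have -> : k%:R - 1 = k.-1%:R :> R by rewrite -[in k%:R](ltn_predK k_gt1) -natr1 addrK.
rewrite /= -mulnDr -(ler_nat R) natrM natrD !natrX -exprnP.
by rewrite lerBlDr ler_pdivrMr // mulrC.
Unshelve. all: by end_near.
Qed.
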